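(* There exist a compact metric space $(X,d_X)$ and a homeomorphism $T:X\to X$ such that $(X,T)$ is completely Li--Yorke chaotic and has positive topological entropy $h_{\rm top}(X,T)>0$.
   Context: A topological dynamical system (t.d.s.) is a pair $(X,T)$ where $X$ is a compact metric space with metric $d_X$ and $T:X\to X$ is a homeomorphism. A proper pair is $(x,y)\in X\times X$ with $x\ne y$. A pair $(x,y)$ is a positively scrambled (Li--Yorke) pair for $T$ if $\liminf_{n\to+\infty}d_X(T^nx,T^ny)=0$ and $\limsup_{n\to+\infty}d_X(T^nx,T^ny)>0$; it is a negatively scrambled pair for $T$ if it is a positively scrambled pair for $T^{-1}$. $(X,T)$ is completely Li--Yorke chaotic (completely scrambled) if each proper pair is either a positively or a negatively scrambled pair for $T$ (inclusive or). Topological entropy: $h_{\rm top}(X,T)=\lim_{\epsilon\to0}\limsup_{n\to\infty}\frac1n\log s_n(X,T,\epsilon)$, where $s_n(X,T,\epsilon)$ is the maximal cardinality of a set $E\subset X$ such that for any distinct $x,y\in E$ there is $0\le n'<n$ with $d_X(T^{n'}x,T^{n'}y)>\epsilon$. *)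

(* Defs.v *)
From HB Require Import structures.
From mathcomp Require Import all_boot all_order all_algebra finmap.
From mathcomp Require Import all_classical all_reals all_analysis.
Import Order.TTheory GRing.Theory Num.Theory.
Import numFieldNormedType.Exports.

Set Implicit Arguments.
Unset Strict Implicit.
Unset Printing Implicit Defensive.

Local Open Scope classical_set_scope.
Local Open Scope ring_scope.

Record homeomorphism (X : topologicalType) := Homeomorphism {
  homeo_fun :> X -> X ;
  homeo_invfun : X -> X ;
  homeo_funK : cancel homeo_fun homeo_invfun ;
  homeo_invfunK : cancel homeo_invfun homeo_fun ;
  homeo_continuous : continuous homeo_fun ;
  homeo_invfun_continuous : continuous homeo_invfun
}.

Definition homeo_inv (X : topologicalType) (T : homeomorphism X) :
    homeomorphism X :=
  Homeomorphism (homeo_invfunK T) (homeo_funK T)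
    (homeo_invfun_continuous (h := T)) (homeo_continuous (h := T)).

Section dynamics.
Context {R : realType} {X : metricType R}.
Implicit Types (T : homeomorphism X) (x y : X).

Definition orbit_dist T x y (n : nat) : R := mdist (iter n T x) (iter n T y).

(* The liminf and limsup are taken in the extended reals, where they exist
   without any boundedness assumption. *)
Definition positively_scrambled T x y : Prop :=
  (limn_einf (fun n => (orbit_dist T x y n)%:E) = 0)%E /\
  (0 < limn_esup (fun n => (orbit_dist T x y n)%:E))%E.

Definition negatively_scrambled T x y : Prop :=
  positively_scrambled (homeo_inv T) x y.

Definition completely_Li_Yorke_chaotic T : Prop :=
  forall x y, x <> y ->
    positively_scrambled T x y \/ negatively_scrambled T x y.

Definition orbit_separated T (n : nat) (e : R) (E : {fset X}) : Prop :=
  forall x y, x \in E -> y \in E -> x <> y ->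
    exists2 k, (k < n)%N & e < orbit_dist T x y k.

(* A subset of a separated set is separated, so restricting to finite sets
   does not change the supremum: an infinite separated set would make it +oo.
   If X is compact and 0 < e, it is finite and attained. *)
Definition max_separated T (n : nat) (e : R) : \bar R :=
  ereal_sup [set (#|` E|%:R)%:E | E in [set E | orbit_separated T n e E]].

(* The limsup is nonincreasing in e, so the limit as e tends to 0 from the
   right exists in the extended reals. *)
Definition topological_entropy T : \bar R :=
  lim (limn_esup (fun n => (n%:R^-1)%:E * lne (max_separated T n e))%E
         @[e --> 0^'+]).

End dynamics.

(* Main.v *)
Require Import Defs.
From HB Require Import structures.
From mathcomp Require Import all_boot all_order all_algebra finmap.
From mathcomp Require Import all_classical all_reals all_analysis.
From mathcomp Require Import zify ring.
Import Order.TTheory GRing.Theory Num.Theory.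
Import numFieldNormedType.Exports.

Set Implicit Arguments.
Unset Strict Implicit.
Unset Printing Implicit Defensive.

(* X is a subshift over the alphabet {blank, 0, 1}.  A point is cut into nested
   blocks: a block of level k+1 consists of [nslots k] slots, the first one
   blank and the others blocks of level k, all written with the same set of
   marked (non-blank) positions and with bitwise sum 0, or all blank.
   - Blank runs of every length occur syndetically, so any two points agree on
     arbitrarily long windows in both directions.
   - If two points cut into blocks in the same way differ somewhere, the
     checksum of each level forces a further difference in another slot of the
     same block, so they differ at infinitely many places.  Two nonzero points
     that agree outside a finite window are cut in the same way, because a
     marked block has exactly one blank slot.  Hence distinct points differ
     infinitely often in at least one direction.
   - One slot is blank and one is determined by the others, so a block of level
     k carries [nfree k] free bits, where [nfree k / blen k] is the product of
     the [1 - 2 / nslots i], which stays above 1/3. *)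

Local Open Scope classical_set_scope.
Local Open Scope ring_scope.

(** * Checksum constraints and homoclinic pairs *)

(* Chosen so that the product of the [1 - 2 / nslots i] telescopes. *)
Definition nslots (k : nat) : nat := (k.+2 * k.+3)%N.
Arguments nslots : simpl never.

Fixpoint blen (k : nat) : nat := if k is k'.+1 then (nslots k' * blen k')%N else 1%N.
Definition bit (c : option bool) : bool := odflt false c.

(** [f j] is the letter at one fixed position inside slot [j]: marks and parity are constrained
    position by position, a blank counting as bit 0. *)
Definition checked (m : nat) (f : nat -> option bool) : Prop :=
  [/\ f 0%N = None,
      forall j, (0 < j < m)%N -> isSome (f j) = isSome (f 1%N) &
      \big[addb/false]_(1 <= j < m) bit (f j) = false].

(** Cuts of level [k.+1] are also cuts of level [k]. Only [a k] modulo [blen k] matters, so [a]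
    represents a point of an odometer. *)
Definition nested (a : nat -> int) : Prop :=
  forall k, (blen k %| a k.+1 - a k)%Z.

(* [a k] is the left end of some block of level k; [i] is the index of a block of
   level k+1, [j] that of a slot and [r] the position inside the slot. *)
Definition conforms (a : nat -> int) (x : int -> option bool) : Prop :=
  forall k (i : int) (r : nat), (r < blen k)%N ->
    checked (nslots k)
      (fun j => x (a k.+1 + i * blen k.+1 + r%:Z + j%:Z * (blen k)%:Z)).

Lemma nslots_ge6 k : (6 <= nslots k)%N. Proof. rewrite /nslots; nia. Qed.

Lemma blen_gt0 k : (0 < blen k)%N.
Proof. by elim: k => //= k IH; rewrite muln_gt0 IH andbT; have := nslots_ge6 k; lia. Qed.

Lemma blenS k : blen k.+1 = (nslots k * blen k)%N. Proof. by []. Qed.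

Lemma blen_ge k : (k < blen k)%N.
Proof. by elim: k => // k IH; rewrite blenS; have := nslots_ge6 k; nia. Qed.

Lemma divz_decomp (n : int) (d : nat) : (0 < d)%N ->
  exists (i : int) (r : nat), (r < d)%N /\ n = i * d%:Z + r%:Z.
Proof.
move=> d0; exists (n %/ d)%Z, `|(n %% d)%Z|%N.
have h1 : (0 <= n %% d)%Z by apply: modz_ge0; lia.
have h2 : (n %% d < d)%Z by apply: ltz_pmod; lia.
split; first lia.
by rewrite {1}(divz_eq n d) gez0_abs.
Qed.

Lemma eq_divmod (i i' : int) (r r' d : nat) : (r < d)%N -> (r' < d)%N ->
  i * d%:Z + r%:Z = i' * d%:Z + r'%:Z -> i = i' /\ r = r'.
Proof.
move=> rd rd' E.
have ii : i = i'.
  case: (ltrgtP i i') => // h.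
    have : (i + 1) * d%:Z <= i' * d%:Z by apply: ler_wpM2r; lia.
    lia.
  have : (i' + 1) * d%:Z <= i * d%:Z by apply: ler_wpM2r; lia.
  lia.
by split=> //; rewrite ii in E; lia.
Qed.

Lemma blk_decomp (a : nat -> int) k (n : int) :
  exists (i : int) (j r : nat), [/\ (j < nslots k)%N, (r < blen k)%N &
    n = a k.+1 + i * blen k.+1 + r%:Z + j%:Z * (blen k)%:Z].
Proof.
have [m [r [rd E]]] := divz_decomp (n - a k.+1) (blen_gt0 k).
have M0 : (0 < nslots k)%N by have := nslots_ge6 k; lia.
have [i [j [jd E']]] := divz_decomp m M0.
by exists i, j, r; split=> //; rewrite blenS PoszM; rewrite E' in E; nia.
Qed.

Definition same_block (a : nat -> int) k (n n' : int) : Prop :=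
  exists (i : int) (r r' : nat), [/\ (r < blen k)%N, (r' < blen k)%N,
    n = a k + i * blen k + r%:Z & n' = a k + i * blen k + r'%:Z].

Lemma same_blockS a k n n' : nested a -> same_block a k n n' -> same_block a k.+1 n n'.
Proof.
move=> /(_ k) /dvdzP[c ac] [i [r [r' [rd rd' -> ->]]]].
have M0 : (0 < nslots k)%N by have := nslots_ge6 k; lia.
have [i' [j [jM E]]] := divz_decomp (i - c) M0.
exists i', (j * blen k + r)%N, (j * blen k + r')%N.
have -> : a k.+1 = a k + c * blen k by rewrite -ac; lia.
have -> : i = i' * nslots k + j%:Z + c by rewrite -E; lia.
rewrite blenS; split; [nia|nia| |]; rewrite ?PoszM ?PoszD ?PoszM; ring.
Qed.

Lemma same_block_le a k k' n n' : nested a -> (k <= k')%N ->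
  same_block a k n n' -> same_block a k' n n'.
Proof.
move=> na /subnKC <-; elim: (k' - k)%N => [|d IH] h; first by rewrite addn0.
by rewrite addnS; apply: same_blockS => //; exact: IH.
Qed.

(** Slots 1 to [m.-1] share their marks, so a difference in marks appears in all of them; if the
    marks agree, a single differing bit would break the parity. *)
Lemma checked_diff m f g j : (2 < m)%N -> checked m f -> checked m g -> (j < m)%N ->
  f j <> g j -> exists j', [/\ (j' < m)%N, j' <> j & f j' <> g j'].
Proof.
move=> m2 [f0 fM fS] [g0 gM gS] jm fg.
have j0 : (0 < j)%N by case: (posnP j) => // j0; rewrite j0 f0 g0 in fg.
have j1m : (0 < j < m)%N by rewrite j0.
case E : (isSome (f j) == isSome (g j)); last first.
  have [j' [j'm j'0 jj']] : exists j', [/\ (j' < m)%N, (0 < j')%N & j' <> j].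
    by exists (if j == 1%N then 2%N else 1%N); case: eqP => ?; split; lia.
  exists j'; split=> // ff; move/eqP: E; apply.
  by rewrite fM // gM // -(fM j') ?j'0 // -(gM j') ?j'0 // ff.
move/eqP: E => E.
have b : bit (f j) <> bit (g j).
  by move=> b; apply: fg; move: E b; case: (f j) => [?|]; case: (g j) => [?|] //= _ ->.
case: (boolP [exists j' : 'I_m, (val j' != j) && (f j' != g j')]).
  by move=> /existsP[j' /andP[/eqP ? /eqP ?]]; exists (val j'); split=> //; exact: ltn_ord.
rewrite negb_exists => /forallP eq_fg; exfalso; apply: b.
have rest : \big[addb/false]_(i <- index_iota 1 m | i != j) bit (f i) =
            \big[addb/false]_(i <- index_iota 1 m | i != j) bit (g i).
  rewrite big_seq_cond [RHS]big_seq_cond; apply: eq_bigr => i.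
  rewrite mem_index_iota => /andP[/andP[_ im] ij].
  by have := eq_fg (Ordinal im); rewrite /= ij /= negbK => /eqP ->.
have ji : j \in index_iota 1 m by rewrite mem_index_iota.
move: fS gS; rewrite (bigD1_seq j) ?iota_uniq //= rest [X in _ -> X = _ -> _](bigD1_seq j) ?iota_uniq //=.
by case: (bit _) (bit _) (\big[_/_]_(_ <- _ | _) _) => [] [] [].
Qed.

Lemma spread_diff a x y n k : nested a -> conforms a x -> conforms a y ->
  x n <> y n ->
  exists n', [/\ same_block a k.+1 n n', ~ same_block a k n n' & x n' <> y n'].
Proof.
move=> na cx cy xy.
have [i [j [r [jM rd nE]]]] := blk_decomp a k n.
have M6 := nslots_ge6 k.
have M2 : (2 < nslots k)%N by lia.
have xyj : x (a k.+1 + i * blen k.+1 + r%:Z + j%:Z * (blen k)%:Z) <>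
   y (a k.+1 + i * blen k.+1 + r%:Z + j%:Z * (blen k)%:Z) by rewrite -nE.
have [j' [j'M j'j xyj']] := checked_diff M2 (cx k i r rd) (cy k i r rd) jM xyj.
exists (a k.+1 + i * blen k.+1 + r%:Z + j'%:Z * (blen k)%:Z); split => //.
  exists i, (j * blen k + r)%N, (j' * blen k + r)%N; rewrite blenS.
  split; [nia|nia| |]; rewrite ?nE ?blenS ?PoszM ?PoszD ?PoszM; ring.
move=> [i1 [r1 [r2 [rd1 rd2 E1 E2]]]].
have /dvdzP[c ac] := na k.
have acE : a k.+1 = a k + c * blen k by rewrite -ac; lia.
rewrite nE in E1.
have F1 : (c + i * nslots k + j%:Z) * (blen k)%:Z + r%:Z = i1 * blen k + r1%:Z.
  by move: E1; rewrite acE blenS PoszM; lia.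
have F2 : (c + i * nslots k + j'%:Z) * (blen k)%:Z + r%:Z = i1 * blen k + r2%:Z.
  by move: E2; rewrite acE blenS PoszM; lia.
have [e1 _] := eq_divmod rd rd1 F1.
have [e2 _] := eq_divmod rd rd2 F2.
by apply: j'j; lia.
Qed.

Lemma inj_unbounded (f : nat -> int) (N : nat) : injective f ->
  exists k, (N < `|f k|)%N.
Proof.
move=> fi.
case: (boolP [exists k : 'I_(N + N).+2, (N < `|f k|)%N]) => [/existsP[k h]|].
  by exists k.
rewrite negb_exists => /forallP h; exfalso.
pose g (k : 'I_(N + N).+2) : 'I_(N + N).+1 := inord (absz (f k + N%:Z)%R).
have gi : injective g.
  move=> k1 k2 /(congr1 val); have := h k1; have := h k2.
  rewrite -!leqNgt => h2 h1; rewrite /= !inordK; [|lia|lia] => E.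
  apply: val_inj; apply: fi => /=; set u := f k1 in E h1 *; set v := f k2 in E h2 *; lia.
by have := leq_card g gi; rewrite !card_ord; lia.
Qed.

(** The difference that [spread_diff] gives at level [k] stays in the block of level [k.+1] around
    [n] but leaves that of level [k], so distinct levels give distinct positions. *)
Lemma diff_unbounded a x y n (N : nat) : nested a -> conforms a x -> conforms a y ->
  x n <> y n -> exists n', (N < `|n'|)%N /\ x n' <> y n'.
Proof.
move=> na cx cy xy.
have /boolp.choice[f hf] := fun k => spread_diff k na cx cy xy.
have fi : injective f.
  suff H : forall k l, (k < l)%N -> f k <> f l.
    move=> k l E; case: (ltngtP k l) => // kl; first by case: (H _ _ kl).
    by case: (H _ _ kl).
  move=> k l kl E; have [sk _ _] := hf k; have [_ nsl _] := hf l.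
  by apply: nsl; rewrite -E; exact: same_block_le sk.
have [k hk] := inj_unbounded N fi.
by exists (f k); split=> //; have [] := hf k.
Qed.

Lemma conforms0 a : conforms a (fun=> None).
Proof. by move=> k i r _; split=> //; rewrite big1. Qed.

Lemma eq_checked m f g : (forall j, (j < m)%N -> f j = g j) -> (1 < m)%N ->
  checked m f -> checked m g.
Proof.
move=> fg m1 [f0 fM fS]; split.
- by rewrite -fg //; lia.
- by move=> j jm; rewrite -!fg ?fM //; lia.
- rewrite -[RHS]fS; apply: eq_big_nat => j jm; by rewrite fg //; lia.
Qed.

Lemma conforms_shift a x (s : int) : conforms a x ->
  conforms (fun k => a k - s) (fun n => x (n + s)).
Proof.
move=> cx k i r rd; apply: eq_checked (cx k i r rd).
  by move=> j _; congr x; ring.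
have := nslots_ge6 k; lia.
Qed.

Lemma nested_shift a (s : int) : nested a -> nested (fun k => a k - s).
Proof. by move=> na k; have -> : a k.+1 - s - (a k - s) = a k.+1 - a k by ring. Qed.

Lemma conforms_congr (a b : nat -> int) x : (forall k, (blen k %| b k - a k)%Z) ->
  conforms a x -> conforms b x.
Proof.
move=> ab cx k i r rd; have /dvdzP[c E] := ab k.+1.
apply: eq_checked (cx k (i + c) r rd); last by have := nslots_ge6 k; lia.
move=> j _; congr x.
have -> : b k.+1 = a k.+1 + c * blen k.+1 by rewrite -E; lia.
ring.
Qed.

Lemma nested_congr (a b : nat -> int) : (forall k, (blen k %| b k - a k)%Z) -> nested a -> nested b.
Proof.
move=> ab na k.
have -> : b k.+1 - b k = (b k.+1 - a k.+1) + ((a k.+1 - a k) - (b k - a k)) by ring.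
have bk : (blen k %| (blen k.+1)%:Z)%Z by apply/dvdzP; exists (nslots k)%:Z; rewrite blenS PoszM.
have h1 := dvdz_trans bk (ab k.+1); have h2 := na k.
by rewrite rpredD // rpredB.
Qed.

(* Far from the origin x and y have the same marks, and the only unmarked
   slot of a marked block is slot 0; hence both cut the line at the same places. *)
Lemma homoclinic_phase a b x y (N : nat) n :
  nested a -> nested b -> conforms a x -> conforms b y ->
  (forall m, (N < `|m|)%N -> x m = y m) -> x n <> None ->
  forall k, (blen k %| a k - b k)%Z.
Proof.
move=> na nb cx cy xy xn; elim=> [|k IH]; first exact: dvd1z.
have M6 := nslots_ge6 k.
(* Compared with the blank point, [x] has marks arbitrarily far out; the margin [blen k.+1] keeps
   the same position in every slot of that block outside the window. *)
have [n' [n'N xn']] := diff_unbounded (N + blen k.+1) na cx (conforms0 a) xn.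
have [i [j [r [jM rd nE]]]] := blk_decomp a k n'.
have [x0 xM _] := cx k i r rd.
have j0 : (0 < j)%N by case: (posnP j) => // j0; rewrite nE j0 x0 in xn'.
pose P := a k.+1 + i * blen k.+1 + r%:Z.
have yP l : (0 < l < nslots k)%N -> y (P + l%:Z * (blen k)%:Z) <> None.
  move=> lM; rewrite -xy; last first.
    move: n'N; rewrite nE -/P blenS => n'N.
    have : (l * blen k < nslots k * blen k)%N by rewrite ltn_mul2r blen_gt0; lia.
    have : (j * blen k < nslots k * blen k)%N by rewrite ltn_mul2r blen_gt0; lia.
    by lia.
  have jm : (0 < j < nslots k)%N by rewrite j0.
  have := etrans (xM j jm) (esym (xM l lM)).
  by rewrite -nE -/P; move: xn'; case: (x n') => // ? _; case: (x _).
have [i' [j' [r' [j'M rd' PE]]]] := blk_decomp b k P.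
have j'0 : j' = 0%N.
  (* If [P] were in a slot [j' > 0] for [b], then moving [nslots k - j'] slots to the right would
     reach slot 0 of the next block of [y], which is blank, against [yP]. *)
  case: (posnP j') => // j'0; case: (yP (nslots k - j')%N); first lia.
  have [y0 _ _] := cy k (i' + 1) r' rd'.
  rewrite -[RHS]y0; congr y; rewrite PE -subzn ?(ltnW j'M) // blenS PoszM; ring.
rewrite j'0 in PE.
(* Equal phases at level [k] give [r = r']; as [P] lies in slot 0 for both cuttings, the phases also
   agree at level [k.+1]. *)
have /dvdzP[c Ec] := IH; have /dvdzP[ca Eca] := na k; have /dvdzP[cb Ecb] := nb k.
have E : (c + ca + i * nslots k) * (blen k)%:Z + r%:Z =
         (cb + i' * nslots k) * blen k + r'%:Z.
  by move: PE; rewrite /P blenS PoszM; lia.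
have [_ rr] := eq_divmod rd rd' E.
by apply/dvdzP; exists (i' - i); move: PE; rewrite /P rr; lia.
Qed.

(** At a differing position one of the points is marked, so by [homoclinic_phase] both are cut
    alike, and [diff_unbounded] contradicts agreement outside the window. *)
Lemma no_homoclinic a b x y (N : nat) :
  nested a -> nested b -> conforms a x -> conforms b y ->
  (forall m, (N < `|m|)%N -> x m = y m) -> x = y.
Proof.
move=> na nb cx cy xy; apply/boolp.funext => n; apply: boolp.contrapT => xyn.
have [p] : exists p, x p <> None \/ y p <> None.
  by exists n; move: xyn; case: (x n) (y n) => [?|] [?|]; [left|left|right|].
have yx m : (N < `|m|)%N -> y m = x m by move=> /xy.
have main : (forall k, (blen k %| a k - b k)%Z) -> False.
  move=> ab; have [n' [n'N]] := diff_unbounded N na cx (conforms_congr ab cy) xyn.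
  by apply; exact: xy.
case=> h; apply: main => k.
  exact: homoclinic_phase na nb cx cy xy h k.
by rewrite -opprB rpredN; exact: homoclinic_phase nb na cy cx yx h k.
Qed.

(** * Long windows of agreement *)

Lemma unmarked_run a x k (n : int) : nested a -> conforms a x ->
  exists c, [/\ n <= c, c <= n + blen k.+1 &
    forall r, (r < blen k)%N -> x (c + r%:Z) = None].
Proof.
move=> na cx; have [i [r [rd E]]] := divz_decomp (n - a k.+1) (blen_gt0 k.+1).
(* The run is slot 0 of the first block of level [k.+1] starting after [n]. *)
exists (a k.+1 + (i + 1) * blen k.+1); split; [lia|lia|].
by move=> s sd; have [h _ _] := cx k (i + 1) s sd; rewrite -[RHS]h; congr x; lia.
Qed.

(** A blank run of [y] of length [blen k] is found inside a much longer blank run of [x]. The bound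
    [W] is uniform, so that windows can also be sought to the left of a given position. *)
Lemma common_run (L : nat) : exists W : nat, forall a b x y (n : int),
  nested a -> nested b -> conforms a x -> conforms b y ->
  exists c, [/\ n <= c, c <= n + W%:Z &
    forall m : int, (`|m| <= L)%N -> x (c + m) = y (c + m)].
Proof.
have [k kE] : exists k, k = (L + L)%N by eexists.
have kL := blen_ge k.
exists (blen k.+3 + blen k.+1 + L)%N => a b x y n na nb cx cy.
have [c [nc cn xc]] := unmarked_run k.+2 n na cx.
have [c' [cc' c'c yc']] := unmarked_run k c nb cy.
have big : (blen k + blen k.+1 < blen k.+2)%N.
  have := nslots_ge6 k.+1; have := nslots_ge6 k; have := blen_gt0 k; rewrite !blenS.
  set d := blen k; set M := nslots k; set M' := nslots k.+1 => d0 M6 M'6.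
  have : (6 * d <= M * d)%N by rewrite leq_mul2r M6 orbT.
  have : (6 * (M * d) <= M' * (M * d))%N by rewrite leq_mul2r M'6 orbT.
  lia.
exists (c' + L%:Z); split; [lia|lia|] => m mL.
have -> : c' + L%:Z + m = c' + (absz (L%:Z + m)%R)%:Z by lia.
rewrite yc'; last lia.
have -> : c' + (absz (L%:Z + m)%R)%:Z = c + (absz (c' - c + L%:Z + m)%R)%:Z by lia.
apply: xc; lia.
Qed.

(** * Points with prescribed blocks *)

Fixpoint nfree (k : nat) : nat :=
  if k is k'.+1 then ((nslots k').-2 * nfree k')%N else 1%N.

Lemma nfreeS k : nfree k.+1 = ((nslots k).-2 * nfree k)%N. Proof. by []. Qed.

(** [s] lists the free bits, read chunk by chunk by slots 1, 2, and so on. The last slot is the sum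
    of the others; its [omap] takes only the marks from [block k' s r]. *)
Fixpoint block (k : nat) (s : seq bool) (o : nat) : option bool :=
  if k is k'.+1 then
    let j := (o %/ blen k')%N in let r := (o %% blen k')%N in
    if j == 0%N then None else
    if j == (nslots k').-1 then
      omap (fun=> \big[addb/false]_(0 <= i < (nslots k').-2)
                    bit (block k' (drop (i * nfree k')%N s) r))
           (block k' s r)
    else block k' (drop (j.-1 * nfree k')%N s) r
  else Some (head false s).

Lemma blockS k s j r : (r < blen k)%N -> block k.+1 s (j * blen k + r)%N =
    if j == 0%N then None else
    if j == (nslots k).-1 then
      omap (fun=> \big[addb/false]_(0 <= i < (nslots k).-2)
                    bit (block k (drop (i * nfree k)%N s) r))
           (block k s r)
    else block k (drop (j.-1 * nfree k)%N s) r.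
Proof. by move=> rd; rewrite /= divnMDl ?blen_gt0 // divn_small // addn0 modnMDl modn_small. Qed.

Lemma isSome_block k s s' o : isSome (block k s o) = isSome (block k s' o).
Proof.
elim: k s s' o => //= k IH s s' o; do 2 case: ifP => // _.
by have := IH s s' (o %% blen k)%N; case: (block k s _); case: (block k s' _).
Qed.

Arguments block : simpl never.

(** For fixed marks the constraints are linear over the field with two elements; hence a checksum
    slot obeys the constraints of all lower levels. *)
Lemma checked_xor m n (f : nat -> option bool) (g : nat -> nat -> option bool) :
  checked m f -> (forall i, checked m (g i)) ->
  (forall i j, isSome (g i j) = isSome (f j)) ->
  checked m (fun j => omap (fun=> \big[addb/false]_(0 <= i < n) bit (g i j)) (f j)).
Proof.
move=> [f0 fM _] cg gf; split.
- by rewrite f0.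
- by move=> j /fM; case: (f j) => [?|]; case: (f 1%N).
- rewrite (eq_bigr (fun j => \big[addb/false]_(0 <= i < n) bit (g i j))).
    rewrite exchange_big big1 // => i _; by have [] := cg i.
  move=> j _; case E : (f j) => [b|] //=; rewrite big1 // => i _.
  by have := gf i j; rewrite E; case: (g i j).
Qed.

Lemma dvdn_blen k l : (k <= l)%N -> (blen k %| blen l)%N.
Proof.
move=> /subnKC <-; elim: (l - k)%N => [|d IH]; first by rewrite addn0.
by rewrite addnS blenS dvdn_mull.
Qed.

(** Induction on [K]. The top level holds by choice of the last slot; a lower block lies inside one
    slot, which is blank, a block one level down, or a sum of such blocks, handled by
    [checked_xor]. *)
Lemma block_checked K s k i r : (k < K)%N -> (r < blen k)%N ->
  (i.+1 * blen k.+1 <= blen K)%N ->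
  checked (nslots k) (fun j => block K s (i * blen k.+1 + r + j * blen k)%N).
Proof.
elim: K s i => // K IH s i; rewrite ltnS leq_eqVlt => /orP[/eqP -> rd iK|kK rd iK].
  have M6 := nslots_ge6 K; have M1 : (1 < nslots K)%N by lia.
  have -> : i = 0%N by have := blen_gt0 K.+1; nia.
  apply: (@eq_checked _ (fun j => block K.+1 s (j * blen K + r)%N)) => //.
    by move=> j _; congr block; lia.
  have marks j : (0 < j)%N ->
      isSome (block K.+1 s (j * blen K + r)%N) = isSome (block K s r).
    rewrite blockS //; case: j => // j _ /=; case: ifP => _.
      by case: (block K s r).
    exact: isSome_block.
  split.
  - by rewrite blockS.
  - by move=> j /andP[j0 _]; rewrite !marks.
  - have -> : nslots K = (nslots K).-2.+2 by lia.
    rewrite big_nat_recr // big_add1 -pred_Sn blockS // ifT; last by apply/eqP; lia.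
    rewrite (eq_big_nat _ _ (F2 := fun j => bit (block K (drop (j * nfree K)%N s) r))).
      case E : (block K s r) => [b|] /=; first by rewrite addbb.
      rewrite big1 // => j _; have := isSome_block K s (drop (j * nfree K) s) r.
      by rewrite E; case: (block K _ r).
    move=> j jM; rewrite blockS // ifF //; apply/eqP. lia.
have /dvdnP[Q QE] := dvdn_blen kK.
have Q0 : (0 < Q)%N by have := blen_gt0 K; rewrite QE; case: (Q).
have M6 := nslots_ge6 k; have M1 : (1 < nslots k)%N by lia.
have d0 := blen_gt0 k.
(* [Q] blocks of level [k.+1] fill a slot of length [blen K]: [i1] is the slot and [i2] the index
   inside it. *)
pose i1 := (i %/ Q)%N; pose i2 := (i %% Q)%N.
have i2Q : (i2 < Q)%N by rewrite ltn_pmod.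
have iE : i = (i1 * Q + i2)%N by exact: divn_eq.
have i2K : (i2.+1 * blen k.+1 <= blen K)%N by rewrite QE leq_mul2r i2Q orbT.
have inK j : (j < nslots k)%N -> (i2 * blen k.+1 + r + j * blen k < blen K)%N.
  by move=> jM; apply: leq_trans i2K; rewrite blenS; nia.
have fE j : (i * blen k.+1 + r + j * blen k =
             i1 * blen K + (i2 * blen k.+1 + r + j * blen k))%N.
  by rewrite {1}iE QE; ring.
pose f s j := block K s (i2 * blen k.+1 + r + j * blen k)%N.
have cf s' : checked (nslots k) (f s') by exact: IH.
apply: (@eq_checked _ (fun j => if i1 == 0%N then None else
    if i1 == (nslots K).-1 then
      omap (fun=> \big[addb/false]_(0 <= l < (nslots K).-2)
                    bit (f (drop (l * nfree K)%N s) j)) (f s j)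
    else f (drop (i1.-1 * nfree K)%N s) j)) => //.
  by move=> j jM; rewrite fE blockS ?inK.
case: eqP => _; first by split=> //; rewrite big1.
case: eqP => _ //; apply: checked_xor => // l j; exact: isSome_block.
Qed.

(** At level [k.+1], bit [i] is read recursively from slot [(i %/ nfree k).+1], since slot 0 is
    blank and the checksum comes last. *)
Lemma block_inj k s s' :
  (forall o, (o < blen k)%N -> block k s o = block k s' o) ->
  forall i, (i < nfree k)%N -> nth false s i = nth false s' i.
Proof.
elim: k s s' => [|k IH] s s' ss' i.
  by rewrite ltnS leqn0 => /eqP ->; have := ss' 0%N isT; rewrite /block -!nth0 => -[].
rewrite nfreeS => iF.
have p0 : (0 < nfree k)%N by case: (nfree k) iF => //; rewrite muln0.
have M6 := nslots_ge6 k.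
pose j := (i %/ nfree k)%N.
have jM : (j < (nslots k).-2)%N by rewrite ltn_divLR.
have := IH (drop (j * nfree k) s) (drop (j * nfree k) s') _ (i %% nfree k)%N (ltn_pmod _ p0).
rewrite !nth_drop -divn_eq; apply => o oB.
have := ss' (j.+1 * blen k + o)%N; rewrite !blockS // !ifF; try by apply/eqP; lia.
apply; rewrite blenS; have : (j.+2 * blen k <= nslots k * blen k)%N by rewrite leq_mul2r; apply/orP; right; lia.
lia.
Qed.

(** The factor [1 - 2 / nslots i] is (i+1)(i+4) / ((i+2)(i+3)), and the product over i < k
    telescopes to (k+3) / (3(k+1)). *)
Lemma nfree_bound k : (blen k * (k + 3) = 3 * k.+1 * nfree k)%N.
Proof.
elim: k => // k IH; rewrite blenS nfreeS; have -> : (nslots k).-2 = (k.+1 * (k + 4))%N by rewrite /nslots; lia.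
apply/eqP; rewrite -(eqn_pmul2r (_ : 0 < k + 3)%N) ?addn_gt0 ?orbT //; apply/eqP.
have -> : (nslots k * blen k * (k.+1 + 3) * (k + 3) = nslots k * (k.+1 + 3) * (blen k * (k + 3)))%N by ring.
by rewrite IH /nslots; ring.
Qed.

(** Place of the origin in the block of level [k] when each block is put in slot 1 of the next: that
    slot reads the same initial bits, and the blocks grow in both directions. *)
Fixpoint offset (k : nat) : nat := if k is k'.+1 then (offset k' + blen k')%N else 0%N.

(** The central block of level [l] has [D >= d] blocks of that level to its left and at least [d] to
    its right. *)
Lemma offset_grow l d : exists D Q : nat, [/\ offset (l + d) = (offset l + D * blen l)%N,
  blen (l + d) = (Q * blen l)%N, (d <= D)%N & (D + d < Q)%N].
Proof.
elim: d => [|d [D [Q [fE bE dD DQ]]]]; first by exists 0%N, 1%N; rewrite addn0; split; lia.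
have M6 := nslots_ge6 (l + d).
exists (D + Q)%N, (nslots (l + d) * Q)%N; rewrite addnS /=; split; [| |lia|nia].
  by rewrite fE bE; ring.
by rewrite bE; ring.
Qed.

(** Level [|n|] is merely one whose block contains position [n]; by [block_stable] every such level
    gives the same letter. *)
Definition codeword (s : seq bool) (n : int) : option bool :=
  block (absz n) s (absz (n + (offset (absz n))%:Z)%R).

Lemma blockS_offset k s o : (o < blen k)%N -> block k.+1 s (o + blen k)%N = block k s o.
Proof.
move=> ok; have -> : (o + blen k = 1 * blen k + o)%N by lia.
have M6 := nslots_ge6 k; rewrite blockS //.
by case: eqP => // _; case: eqP => [|_]; [lia|rewrite mul0n drop0].
Qed.

Lemma block_stable k d s (n : int) : 0 <= n + (offset k)%:Z < blen k ->
  block (k + d) s (absz (n + (offset (k + d)))%R) =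
  block k s (absz (n + (offset k))%R).
Proof.
move=> nk; suff [// _] :
    block (k + d) s (absz (n + (offset (k + d)))%R) =
    block k s (absz (n + (offset k))%R) /\
    0 <= n + (offset (k + d))%:Z < blen (k + d).
elim: d => [|d [<- nkd]]; first by rewrite addn0.
have M6 := nslots_ge6 (k + d).
rewrite addnS /=; split; last by nia.
rewrite -(@blockS_offset _ _ (absz (n + (offset (k + d)))%R)); last by lia.
by congr (block _ _ _); lia.
Qed.

Lemma codeword_range (n : int) d : (`|n| <= d)%N -> 0 <= n + (offset d)%:Z < blen d.
Proof. by move=> nd; have [D [Q]] := offset_grow 0 d; rewrite add0n /= => -[]; lia. Qed.

Lemma codewordE k s (n : int) : 0 <= n + (offset k)%:Z < blen k ->
  codeword s n = block k s (absz (n + (offset k))%R).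
Proof.
move=> nk; rewrite -(block_stable `|n|%N) // addnC block_stable //.
exact: codeword_range.
Qed.

Lemma nested_offset : nested (fun k => - (offset k)%:Z).
Proof.
by move=> k; apply/dvdzP; exists (-1); rewrite /=; lia.
Qed.

Lemma conforms_codeword s : conforms (fun k => - (offset k)%:Z) (codeword s).
Proof.
move=> k i r rd.
(* Going up [|i|] levels makes the [i]-th block of level [k.+1] part of the central block of level
   [K]. *)
have [D [Q [fE bE dD DQ]]] := offset_grow k.+1 `|i|%N.
set K := (k.+1 + _)%N in fE bE.
have kK : (k < K)%N by rewrite /K addSn ltnS leq_addr.
have M6 := nslots_ge6 k.
have b0 := blen_gt0 k.+1.
have iK : ((absz (i + D%:Z)%R).+1 * blen k.+1 <= blen K)%N.
  by rewrite bE leq_mul2r; apply/orP; right; lia.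
apply: eq_checked (block_checked s kK rd iK); last lia.
move=> j jM.
have lt : (r + j * blen k < blen k.+1)%N by rewrite blenS; nia.
have E : - (offset k.+1)%:Z + i * blen k.+1 + r%:Z + j%:Z * (blen k)%:Z + (offset K)%:Z
   = (absz (i + D%:Z)%R * blen k.+1 + r + j * blen k)%N%:Z.
  rewrite fE; move: (offset k.+1) (blen k.+1) (blen k) => u v w; rewrite !PoszD !PoszM; have -> : (absz (i + D%:Z)%R)%:Z = i + D by lia.
  ring.
rewrite (@codewordE K); first by rewrite E.
rewrite E; apply/andP; split=> //; apply: leq_trans iK; lia.
Qed.

(** * The subshift as a compact metric space *)

Definition valid (x : int -> option bool) : Prop :=
  exists a, nested a /\ conforms a x.

Definition differ (x y : int -> option bool) (m : nat) : bool :=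
  (x m%:Z != y m%:Z) || (x (- m%:Z) != y (- m%:Z)).

Definition seqdist (R : realType) (x y : int -> option bool) : R :=
  if pselect (exists m, differ x y m) is left h then (ex_minn h).+1%:R^-1 else 0.

Section Seqdist.
Context (R : realType).
Implicit Types x y z : int -> option bool.
Local Notation dist := (seqdist R).

Lemma seqdist_ge0 x y : 0 <= dist x y.
Proof. by rewrite /seqdist; case: pselect => // h; rewrite invr_ge0. Qed.

Lemma differC x y : differ x y = differ y x.
Proof. by apply/funext => m; rewrite /differ ![_ == y _]eq_sym. Qed.

Lemma seqdistC x y : dist x y = dist y x.
Proof. by rewrite /seqdist differC. Qed.

Lemma seqdist_le x y N :
  dist x y <= N.+1%:R^-1 <-> forall n : int, (`|n| < N)%N -> x n = y n.
Proof.
have neqP m : reflect (x m%:Z <> y m%:Z \/ x (- m%:Z) <> y (- m%:Z)) (differ x y m).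
  by apply: (iffP orP) => -[] /eqP; [left|right|left|right].
rewrite /seqdist; case: pselect => [h|h]; last first.
  split=> [_ n _|_]; last by rewrite invr_ge0.
  apply: contrapT => xyn; apply: h; exists `|n|%N; apply/neqP.
  case: (intP n) xyn => [|m|m] ?; [left|left|right] => //.
case: ex_minnP => m dm mmin; rewrite lef_pV2 ?posrE ?ltr0Sn // ler_nat ltnS.
split=> [Nm n nN|xy].
  apply: contrapT => xyn; suff : (m <= `|n|)%N by lia.
  apply: mmin; apply/neqP.
  case: (intP n) xyn => [|p|p] ?; [left|left|right] => //.
rewrite leqNgt; apply/negP => mN; move/neqP: dm => [|]; apply; apply: xy; lia.
Qed.

Lemma seqdistxx x : dist x x = 0.
Proof.
rewrite /seqdist; case: pselect => // h; exfalso; case: h => m; by rewrite /differ !eqxx.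
Qed.

Lemma seqdist_eq0 x y : dist x y = 0 -> x = y.
Proof.
move=> d0; apply/funext => n; have [h _] := seqdist_le x y `|n|.+1%N.
by apply: h; rewrite ?d0 ?invr_ge0.
Qed.

Lemma seqdist_cases x y : dist x y = 0 \/ exists m : nat, dist x y = m.+1%:R^-1.
Proof.
by rewrite /seqdist; case: pselect => h; [right; eexists|left].
Qed.

Lemma seqdist_lt x y m :
  dist x y < m.+1%:R^-1 <-> forall n : int, (`|n| <= m)%N -> x n = y n.
Proof.
rewrite -[X in _ <-> X](seqdist_le x y m.+1); split.
  have [->|[p ->]] := seqdist_cases x y; first by rewrite invr_ge0.
  by rewrite ltf_pV2 ?posrE ?ltr0Sn // lef_pV2 ?posrE ?ltr0Sn // ltr_nat ler_nat.
by move/le_lt_trans; apply; rewrite ltf_pV2 ?posrE ?ltr0Sn // ltr_nat.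
Qed.

Lemma seqdist_triangle y x z : dist x z <= dist x y + dist y z.
Proof.
(* The stronger ultrametric inequality holds. *)
suff : dist x z <= Num.max (dist x y) (dist y z).
  by move/le_trans; apply; rewrite ge_max lerDl lerDr !seqdist_ge0.
rewrite le_max leNgt [X in _ || X]leNgt -negb_and; apply/negP => /andP[].
have [->|[m mE]] := seqdist_cases x z; first by rewrite ltNge seqdist_ge0.
rewrite mE => /seqdist_lt xy /seqdist_lt yz.
have : dist x z < m.+1%:R^-1 by apply/seqdist_lt => n nm; rewrite xy // yz.
by rewrite mE ltxx.
Qed.

Lemma exists_inv_lt (e : R) : 0 < e -> exists m : nat, m.+1%:R^-1 < e.
Proof.
move=> e0; exists (Num.truncn e^-1).
by rewrite invf_plt ?posrE ?ltr0Sn // truncnS_gt.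
Qed.

End Seqdist.

Definition subshift (R : realType) : Type := {x : int -> option bool | valid x}.

HB.instance Definition _ (R : realType) := gen_eqMixin (subshift R).
HB.instance Definition _ (R : realType) := gen_choiceMixin (subshift R).

Lemma subshift_eqP (R : realType) (p q : subshift R) : sval p = sval q -> p = q.
Proof. by case: p q => [x vx] [y vy] /= xy; exact: eq_exist. Qed.

Lemma subshift_dist_eq0 (R : realType) (p q : subshift R) :
  seqdist R (sval p) (sval q) = 0 -> p = q.
Proof. by move/seqdist_eq0; exact: subshift_eqP. Qed.

HB.instance Definition _ (R : realType) :=
  isMetric.Build R (subshift R)
    (fun p => seqdistxx R (sval p)) (@subshift_dist_eq0 R)
    (fun p q => seqdistC R (sval p) (sval q))
    (fun q p r => seqdist_triangle R (sval q) (sval p) (sval r)).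

Section Space.
Context (R : realType).
Local Notation X := (subshift R).
Implicit Types p q : X.

Lemma subshift_mdist_lt p q m :
  mdist p q < m.+1%:R^-1 <-> forall n : int, (`|n| <= m)%N -> sval p n = sval q n.
Proof. exact: seqdist_lt. Qed.

Lemma subshift_mdist_lt1 p q : mdist p q < 1 -> sval p 0 = sval q 0.
Proof. by move=> pq; apply: (subshift_mdist_lt p q 0).1 => //; rewrite invr1. Qed.

Lemma subshift_nbhsP (p : X) (A : set X) : nbhs p A <->
  exists m : nat, forall q, (forall n : int, (`|n| <= m)%N -> sval p n = sval q n) -> A q.
Proof.
rewrite -nbhs_ballE; split=> [[e /= e0 eA]|[m mA]].
  have [m me] := exists_inv_lt e0; exists m => q pq; apply: eA.
  by rewrite ballEmdist /=; apply: lt_trans me; apply/subshift_mdist_lt.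
exists m.+1%:R^-1; first by rewrite /= invr_gt0.
by move=> q; rewrite ballEmdist /= => /subshift_mdist_lt; exact: mA.
Qed.

(** * Compactness by ultrafilters *)

Lemma ultra_finite (T : Type) (F : set_system T) (I : finType) (f : T -> I) :
  UltraFilter F -> exists v, F [set t | f t = v].
Proof.
move=> FU; apply: contrapT => h.
have hv v : F [set t | f t <> v].
  have [] := in_ultra_setVsetC [set t | f t = v] FU => // Fv.
  by case: h; exists v.
have : F [set t | forall v, f t <> v] by apply: filter_forall.
by move/filter_ex => [t /(_ (f t))].
Qed.

Lemma ultra_bounded (T : Type) (F : set_system T) (N : nat) (f : T -> nat) :
  UltraFilter F -> (forall t, (f t < N)%N) -> exists v, F [set t | f t = v].
Proof.
move=> FU fN; have [v hv] := ultra_finite (fun t => Ordinal (fN t)) FU.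
by exists (val v); apply: filterS hv => t /= /(congr1 val).
Qed.

(* [a k] only matters modulo [blen k], so it may be taken in a finite range,
   where ultrafilter limits exist. *)
Lemma bounded_phase x : valid x -> exists a : nat -> nat,
  [/\ forall k, (a k < blen k)%N, nested (fun k => (a k)%:Z) & conforms (fun k => (a k)%:Z) x].
Proof.
move=> [a [na ca]]; pose b k := `|(a k %% blen k)%Z|%N.
have bE k : (b k)%:Z = (a k %% blen k)%Z.
  by rewrite /b gez0_abs // modz_ge0 //; have := blen_gt0 k; lia.
have ab k : (blen k %| (b k)%:Z - a k)%Z.
  by rewrite bE {2}(divz_eq (a k) (blen k)); apply/dvdzP; exists (- (a k %/ blen k)%Z); lia.
exists b; split.
- by move=> k; have := blen_gt0 k; have := @ltz_pmod (a k) (blen k); rewrite -bE; lia.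
- exact: nested_congr ab na.
- exact: conforms_congr ab ca.
Qed.

(** Each letter and each bounded phase is constant on a set of the ultrafilter, which defines a
    limit point and its cutting. A constraint involves finitely many positions, so it passes to the
    limit. *)
Lemma subshift_compact : compact [set: X].
Proof.
rewrite compact_ultra => F FU _.
have [x hx] : {x : int -> option bool & forall n, F [set p : X | sval p n = x n]}.
  by apply: (@choice _ _ (fun n v => F [set p : X | sval p n = v])) => n; exact: ultra_finite.
have [ph hph] := @choice _ _ _ (fun p : X => bounded_phase (svalP p)).
have [a ha] : {a : nat -> nat & forall k, F [set p | ph p k = a k]}.
  apply: (@choice _ _ (fun k v => F [set p : X | ph p k = v])) => k.
  by apply: (@ultra_bounded _ _ (blen k)) => // p; have [] := hph p.
have near_x m : F [set p : X | forall n : int, (`|n| <= m)%N -> sval p n = x n].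
  have h : F [set p : X | forall i : 'I_m.+1, sval p i%:Z = x i%:Z /\ sval p (- i%:Z) = x (- i%:Z)].
    apply: filter_forall => i; exact: filterI (hx _) (hx _).
  apply: filterS h => p hp n nm; have i_lt : (`|n| < m.+1)%N by rewrite ltnS.
  have /= [h1 h2] := hp (Ordinal i_lt).
  by case: (ler0P n) => n0; [rewrite (_ : n = - `|n|%N%:Z)|rewrite (_ : n = `|n|%N%:Z)] => //; lia.
have na : nested (fun k => (a k)%:Z).
  move=> k; have [p /= [<- <-]] := filter_ex (filterI (ha k) (ha k.+1)).
  by have [_ + _] := hph p; apply.
have ca : conforms (fun k => (a k)%:Z) x.
  move=> k i r rd.
  pose pos j := (a k.+1)%:Z + i * blen k.+1 + r%:Z + j%:Z * (blen k)%:Z.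
  (* The sum serves as a common bound for the positions in this constraint. *)
  pose m := (\sum_(j < nslots k) `|pos j|)%N.
  have [p /= [pa px]] := filter_ex (filterI (ha k.+1) (near_x m)).
  have [_ _ /(_ k i r rd)] := hph p; rewrite pa => cp.
  apply: eq_checked cp; last by have := nslots_ge6 k; lia.
  move=> j jM; apply: px; rewrite -/(pos j) /m.
  by rewrite (bigD1 (Ordinal jM)) //= leq_addr.
have vx : valid x by exists (fun k => (a k)%:Z).
exists (exist _ x vx); split=> // A /subshift_nbhsP[m mA].
by apply: filterS (near_x m) => p pm; apply: mA => n nm /=; rewrite pm.
Qed.

(** * The shift homeomorphism *)

Lemma valid_shift (s : int) x : valid x -> valid (fun n => x (n + s)).
Proof.
move=> [a [na ca]]; exists (fun k => a k - s); split.
  exact: nested_shift.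
exact: conforms_shift.
Qed.

Definition shift_by (s : int) (p : X) : X := exist _ _ (valid_shift s (svalP p)).

Lemma shift_byD s t p : shift_by s (shift_by t p) = shift_by (s + t) p.
Proof. by apply: subshift_eqP; apply/funext => n /=; congr (sval p _); ring. Qed.

Lemma shift_by0 p : shift_by 0 p = p.
Proof. by apply: subshift_eqP; apply/funext => n /=; rewrite addr0. Qed.

Lemma shift_by_continuous s : continuous (shift_by s).
Proof.
move=> p A /subshift_nbhsP[m mA]; apply/subshift_nbhsP; exists (m + `|s|)%N => q pq.
by apply: mA => n nm /=; apply: pq; lia.
Qed.

Lemma shift_byK s : cancel (shift_by s) (shift_by (- s)).
Proof. by move=> p; rewrite shift_byD addNr shift_by0. Qed.

Lemma shift_byNK s : cancel (shift_by (- s)) (shift_by s).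
Proof. by move=> p; rewrite shift_byD subrr shift_by0. Qed.

Definition shift_homeo : homeomorphism X :=
  Homeomorphism (shift_byK 1) (shift_byNK 1)
    (@shift_by_continuous 1) (@shift_by_continuous (- 1)).

Lemma iter_shift n p : iter n shift_homeo p = shift_by n%:Z p.
Proof.
elim: n => [|n IH] /=; first by rewrite shift_by0.
by rewrite IH shift_byD; congr shift_by; lia.
Qed.

Lemma iter_shiftN n p : iter n (homeo_inv shift_homeo) p = shift_by (- n%:Z) p.
Proof.
elim: n => [|n IH] /=; first by rewrite shift_by0.
by rewrite IH shift_byD; congr shift_by; lia.
Qed.

End Space.

(** * Chaos and entropy *)

Section Limits.
Context (R : realType).

Lemma limn_esup_ge (u : nat -> \bar R) (c : \bar R) :
  (forall N, exists2 n, (N <= n)%N & (c <= u n)%E) -> (c <= limn_esup u)%E.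
Proof.
move=> cu; rewrite limn_esup_lim; apply: lime_ge; first exact: is_cvg_esups.
apply: nearW => N; have [n Nn cn] := cu N.
by apply: le_ereal_sup_tmp; exists (u n) => //; exists n.
Qed.

Lemma le_limn_esup (u v : nat -> \bar R) :
  (forall n, (u n <= v n)%E) -> (limn_esup u <= limn_esup v)%E.
Proof.
move=> uv; rewrite !limn_esup_lim; apply: lee_lim; [exact: is_cvg_esups..|].
apply: nearW => N; apply: ge_ereal_sup => _ [n Nn <-].
by apply: le_ereal_sup_tmp; exists (v n) => //; exists n.
Qed.

Lemma limn_einf_eq0 (u : nat -> R) : (forall n, 0 <= u n) ->
  (forall e N, 0 < e -> exists2 n, (N <= n)%N & u n < e) ->
  (limn_einf (fun n => (u n)%:E) = 0)%E.
Proof.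
move=> u0 ue; rewrite limn_einf_lim.
suff -> : einfs (fun n => (u n)%:E) = cst 0%E by exact: lim_cst.
apply/funext => N; apply/eqP; rewrite eq_le; apply/andP; split.
  apply/lee_addgt0Pr => e e0; have [n Nn ne] := ue e N e0.
  rewrite add0e; apply: ge_ereal_inf; exists (u n)%:E; first by exists n.
  by rewrite lee_fin ltW.
by apply: le_ereal_inf_tmp => _ [n Nn <-]; rewrite lee_fin.
Qed.

End Limits.

Section Dynamics.
Context (R : realType).
Local Notation X := (subshift R).
Implicit Types p q : X.

(** Agreement on long windows makes the liminf 0; a difference at coordinate 0 means distance at
    least 1, so recurring ones make the limsup positive. The times [s] cover the shift and its
    inverse alike. *)
Lemma scrambledI (T : homeomorphism X) (s : nat -> int) p q :
  (forall n r, iter n T r = shift_by (s n) r) ->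
  (forall L N, exists2 n, (N <= n)%N & forall m : int, (`|m| <= L)%N ->
    sval p (s n + m) = sval q (s n + m)) ->
  (forall N, exists2 n, (N <= n)%N & sval p (s n) <> sval q (s n)) ->
  positively_scrambled T p q.
Proof.
move=> Ts agree diff; split.
  apply: limn_einf_eq0 => [n|e N e0]; first exact: mdist_ge0.
  have [L Le] := exists_inv_lt e0; have [n Nn pq] := agree L N.
  exists n => //; apply: lt_trans Le; rewrite /orbit_dist !Ts.
  by apply/subshift_mdist_lt => m mL /=; rewrite addrC pq.
apply: (@lt_le_trans _ _ 1%:E); first by rewrite lte_fin.
apply: limn_esup_ge => N; have [n Nn pq] := diff N; exists n => //.
rewrite lee_fin /orbit_dist !Ts leNgt; apply/negP.
by move/subshift_mdist_lt1; rewrite /= add0r.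
Qed.

Lemma shift_chaotic : completely_Li_Yorke_chaotic (shift_homeo R).
Proof.
move=> p q pq.
have [a [na ca]] := svalP p; have [b [nb cb]] := svalP q.
have [hpos|] := pselect (forall N : nat, exists2 n, (N <= n)%N & sval p n%:Z <> sval q n%:Z).
  left; apply: (@scrambledI _ (fun n => n%:Z)) => //; first exact: iter_shift.
  move=> L N; have [W hW] := common_run L.
  have [c [nc _ hc]] := hW _ _ _ _ N%:Z na nb ca cb.
  exists `|c|%N; first lia.
  by have -> : `|c|%N%:Z = c by lia.
move=> /existsNP[N hN].
right; apply: (@scrambledI _ (fun n => - n%:Z)); first exact: iter_shiftN.
  move=> L N'; have [W hW] := common_run L.
  (* Starting at [- (N' + W)] ensures [c <= - N']. *)
  have [c [nc cn hc]] := hW _ _ _ _ (- (N' + W)%N%:Z) na nb ca cb.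
  exists `|c|%N; first lia.
  by have -> : - `|c|%N%:Z = c by lia.
(* The points agree to the right from [N] on; if they also agreed to the left beyond [N'],
   [no_homoclinic] would make them equal. *)
move=> N'; apply: contrapT => h; apply: pq; apply: subshift_eqP.
apply: (no_homoclinic (N := maxn N N') na nb ca cb) => m mN.
apply: contrapT => neq; case: (intP m) mN neq => [|n|n] mN neq; first lia.
  by apply: hN; exists n.+1 => //; lia.
by apply: h; exists n.+1 => //; lia.
Qed.

(** * Positive entropy *)

Lemma max_separated_ge0 (T : homeomorphism X) n e : (0 <= max_separated T n e)%E.
Proof.
by apply: le_ereal_sup_tmp; exists 0%E => //; exists fset0 => //=; rewrite cardfs0.
Qed.

Lemma le_max_separated (T : homeomorphism X) n e e' : e <= e' ->
  (max_separated T n e' <= max_separated T n e)%E.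
Proof.
move=> ee'; apply: ereal_sup_le => _ [E sE <-]; exists E => // x y xE yE xy.
by have [k kn ek] := sE x y xE yE xy; exists k => //; exact: le_lt_trans ek.
Qed.

(** The shift moves the left end of the block of level [K] to 0, so [blen K] iterates read the whole
    block. *)
Definition code K (s : seq bool) : X :=
  shift_by (- (offset K)%:Z)
    (exist _ (codeword s) (ex_intro _ _ (conj nested_offset (conforms_codeword s)))).

Lemma codeE K s o : (o < blen K)%N -> sval (code K s) o%:Z = block K s o.
Proof.
move=> oK /=; rewrite (@codewordE K) ?subrK //.
Qed.

Lemma code_neq K (s s' : seq bool) : size s = nfree K -> size s' = nfree K ->
  s <> s' -> exists2 o, (o < blen K)%N & block K s o <> block K s' o.
Proof.
move=> ss ss' neq; apply: contrapT => h; apply: neq.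
apply: (@eq_from_nth _ false); first by rewrite ss ss'.
rewrite ss; apply: block_inj => o oK; apply: contrapT => bo; apply: h; by exists o.
Qed.

Lemma max_separated_code K (e : R) : e < 1 ->
  ((2 ^ nfree K)%:R%:E <= max_separated (shift_homeo R) (blen K) e)%E.
Proof.
move=> e1; pose c (t : (nfree K).-tuple bool) := code K t.
have cneq t t' : t <> t' -> exists2 o, (o < blen K)%N &
    sval (c t) o%:Z <> sval (c t') o%:Z.
  move=> tt'; have vtt' : val t <> val t' by move=> /val_inj.
  have [i iK bi] := code_neq (size_tuple t) (size_tuple t') vtt'.
  by exists i => //; rewrite !codeE.
have cinj : injective c.
  move=> t t' cc; apply: contrapT => /cneq[i _]; by rewrite cc.
apply: le_ereal_sup_tmp; exists (2 ^ nfree K)%:R%:E => //.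
exists [fset c t | t in [set: (nfree K).-tuple bool]%SET]%fset; last first.
  by rewrite card_imfset //= -cardE cardsT card_tuple card_bool.
move=> _ _ /imfsetP[t _ ->] /imfsetP[t' _ ->] cc.
have [|i iK neq] := cneq t t'; first by move=> tt'; apply: cc; rewrite tt'.
exists i => //; apply: lt_le_trans e1 _; rewrite /orbit_dist !iter_shift leNgt.
by apply/negP => /subshift_mdist_lt1; rewrite /= add0r.
Qed.

Lemma entropy_rate_ge (e : R) : e < 1 ->
  ((ln 2 / 3)%:E <= limn_esup (fun n =>
     (n%:R^-1)%:E * lne (max_separated (shift_homeo R) n e)))%E.
Proof.
(* A limsup may be bounded along the lengths [blen N], where the [2 ^ nfree N] codes are separated
   and [nfree_bound] gives [blen N <= 3 * nfree N]. *)
move=> e1; apply: limn_esup_ge => N; exists (blen N); first exact: ltnW (blen_ge N).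
have b0 : 0 < (blen N)%:R :> R by rewrite ltr0n blen_gt0.
apply: (@le_trans _ _ (((blen N)%:R^-1)%:E * lne (2 ^ nfree N)%:R%:E)%E); last first.
  apply: lee_wpmul2l; first by rewrite lee_fin invr_ge0.
  by rewrite lee_lne ?in_itv /= ?leey ?andbT ?max_separated_ge0 ?lee_fin // max_separated_code.
rewrite lne_EFin ?ltr0n ?expn_gt0 // -EFinM lee_fin natrX lnXn // [X in _ <= X]mulrC ler_pdivlMr //.
have l2 : 0 <= ln 2 :> R by rewrite ln_ge0 // ler1n.
rewrite mulrAC ler_pdivrMr // -[ln 2 *+ _]mulr_natr -mulrA. rewrite ler_wpM2l // -natrM ler_nat.
have := nfree_bound N; nia.
Qed.

Lemma shift_entropy_gt0 : (0 < topological_entropy (shift_homeo R))%E.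
Proof.
rewrite /topological_entropy; set h := fun e : R => limn_esup _.
(* By monotonicity in [e] the limit at 0 is a supremum, bounded below by the value at 1/2. *)
have /cvg_lim -> // : h e @[e --> 0^'+] --> ereal_sup (h @` [set` `]0, 1[ ]).
  apply: (nonincreasing_at_right_cvge (BLeft 1)); first by rewrite bnd_simp.
  move=> e e' _ _ ee'; apply: le_limn_esup => n.
  apply: lee_wpmul2l; first by rewrite lee_fin invr_ge0.
  by rewrite lee_lne ?in_itv /= ?leey ?andbT ?max_separated_ge0 // le_max_separated.
apply: (@lt_le_trans _ _ (ln 2 / 3)%:E).
  by rewrite lte_fin divr_gt0 // ln_gt0 // ltr1n.
apply: le_ereal_sup_tmp; exists (h 2^-1).
  by exists 2^-1 => //=; rewrite in_itv /= invr_gt0 ltr0n invf_lt1 ?ltr1n.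
by apply: entropy_rate_ge; rewrite invf_lt1 ?ltr1n.
Qed.

End Dynamics.

Theorem theorem1p1 (R : realType) :
  exists (X : metricType R) (T : homeomorphism X),
    [/\ compact [set: X],
        completely_Li_Yorke_chaotic T &
        (0 < topological_entropy T)%E].
Proof.
by exists (subshift R), (shift_homeo R); split;
  [exact: subshift_compact|exact: shift_chaotic|exact: shift_entropy_gt0].
Qed.
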